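(* There is an absolute constant $C$ such that for every $n\ge 2$ there exists a set $\mathcal{P}$ of $n$ points in the double plane $\mathbb{S}^2$ with $D(\mathcal{P})\le C\,\dfrac{n}{\log n}$.
   Context: The double numbers $\mathbb{S}$ are the two-dimensional unital associative $\mathbb{R}$-algebra obtained by adjoining to $\mathbb{R}$ an element $j$ with $j^2=1$. Each double number is uniquely $X+Yj$ with $X,Y\in\mathbb{R}$; it is denoted $\langle x,y\rangle$ where $x=X+Y$ and $y=X-Y$. A point $(X+Yj,Z+Wj)\in\mathbb{S}^2$ is denoted $\langle x,y,z,w\rangle$ where $x=X+Y$, $y=X-Y$, $z=Z+W$, $w=Z-W$. The distance function $\rho_{\mathbb{S}^2}:\mathbb{S}^2\times\mathbb{S}^2\to\mathbb{S}$ is $\rho_{\mathbb{S}^2}((a,b),(a',b'))=(a-a')^2+(b-b')^2$ (arithmetic in $\mathbb{S}$). In the new coordinates, \[\rho_{\mathbb{S}^2}(\langle x,y,z,w\rangle,\langle x',y',z',w'\rangle)=\langle (x-x')^2+(z-z')^2,\ (y-y')^2+(w-w')^2\rangle .\] $D(\mathcal{P})$ denotes the number of distinct distances determined by $\mathcal{P}$, i.e. the cardinality of $\{\rho_{\mathbb{S}^2}(p,q): p,q\in\mathcal{P}\}\subset\mathbb{S}$. *)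

(* Defs.v *)
From HB Require Import structures.
From mathcomp Require Import all_boot all_order all_algebra finmap.
From mathcomp Require Import reals exp.
From mathcomp.algebra_tactics Require Import ring.

Set Implicit Arguments.
Unset Strict Implicit.
Unset Printing Implicit Defensive.

Import Order.TTheory GRing.Theory Num.Theory.

Local Open Scope fset_scope.
Local Open Scope ring_scope.

(* [Dbl X Y] is X + Y j, with j ^+ 2 = 1 (lemma [dblj_sqr]). *)
Record dbl (R : Type) : Type := Dbl { dbl_re : R; dbl_j : R }.

Definition dbl_to_pair (R : Type) (u : dbl R) : R * R := (dbl_re u, dbl_j u).
Definition dbl_of_pair (R : Type) (p : R * R) : dbl R := Dbl p.1 p.2.
Lemma dbl_to_pairK (R : Type) : cancel (@dbl_to_pair R) (@dbl_of_pair R).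
Proof. by case. Qed.

Section DoubleNumbers.
Variable R : realType.
Implicit Types (u v w : dbl R) (a b : R).

HB.instance Definition _ := Choice.copy (dbl R) (can_type (@dbl_to_pairK R)).

Definition dbl_zero : dbl R := Dbl 0 0.
Definition dbl_opp u : dbl R := Dbl (- dbl_re u) (- dbl_j u).
Definition dbl_add u v : dbl R :=
  Dbl (dbl_re u + dbl_re v) (dbl_j u + dbl_j v).
Definition dbl_one : dbl R := Dbl 1 0.
Definition dbl_mul u v : dbl R :=
  Dbl (dbl_re u * dbl_re v + dbl_j u * dbl_j v)
      (dbl_re u * dbl_j v + dbl_j u * dbl_re v).
Definition dbl_scale a u : dbl R := Dbl (a * dbl_re u) (a * dbl_j u).

Fact dbl_addA : associative dbl_add.
Proof. by move=> u v w; rewrite /dbl_add /= !addrA. Qed.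
Fact dbl_addC : commutative dbl_add.
Proof. by move=> u v; congr Dbl; rewrite addrC. Qed.
Fact dbl_add0 : left_id dbl_zero dbl_add.
Proof. by case=> X Y; rewrite /dbl_add /= !add0r. Qed.
Fact dbl_addN : left_inverse dbl_zero dbl_opp dbl_add.
Proof. by move=> u; rewrite /dbl_add /= !addNr. Qed.

HB.instance Definition _ := GRing.isZmodule.Build (dbl R)
  dbl_addA dbl_addC dbl_add0 dbl_addN.

Fact dbl_mulA : associative dbl_mul.
Proof. by case=> ? ? [? ?] [? ?]; congr Dbl => /=; ring. Qed.
Fact dbl_mulC : commutative dbl_mul.
Proof. by case=> ? ? [? ?]; congr Dbl => /=; ring. Qed.
Fact dbl_mul1 : left_id dbl_one dbl_mul.
Proof. by case=> ? ?; congr Dbl => /=; ring. Qed.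
Fact dbl_mulDl : left_distributive dbl_mul dbl_add.
Proof. by case=> ? ? [? ?] [? ?]; congr Dbl => /=; ring. Qed.
Fact dbl_oner_neq0 : dbl_one != 0.
Proof. by apply/eqP => -[] /eqP; rewrite oner_eq0. Qed.

HB.instance Definition _ := GRing.Zmodule_isComNzRing.Build (dbl R)
  dbl_mulA dbl_mulC dbl_mul1 dbl_mulDl dbl_oner_neq0.

Fact dbl_scaleA a b u : dbl_scale a (dbl_scale b u) = dbl_scale (a * b) u.
Proof. by congr Dbl => /=; rewrite mulrA. Qed.
Fact dbl_scale1 : left_id 1 dbl_scale.
Proof. by case=> X Y; rewrite /dbl_scale /= !mul1r. Qed.
Fact dbl_scaleDr : right_distributive dbl_scale +%R.
Proof. by move=> a u v; congr Dbl => /=; rewrite mulrDr. Qed.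
Fact dbl_scaleDl u : {morph dbl_scale^~ u : a b / a + b}.
Proof. by move=> a b; congr Dbl => /=; rewrite mulrDl. Qed.

HB.instance Definition _ := GRing.Zmodule_isLmodule.Build R (dbl R)
  dbl_scaleA dbl_scale1 dbl_scaleDr dbl_scaleDl.

Fact dbl_scaleAl a u v : a *: (u * v) = (a *: u) * v.
Proof. by case: u v => ? ? [? ?]; congr Dbl => /=; ring. Qed.

HB.instance Definition _ :=
  GRing.Lmodule_isLalgebra.Build R (dbl R) dbl_scaleAl.
HB.instance Definition _ := GRing.Lalgebra_isComAlgebra.Build R (dbl R).

Definition dblj : dbl R := Dbl 0 1.

Lemma dblj_sqr : dblj ^+ 2 = 1.
Proof. by rewrite expr2; congr Dbl => /=; ring. Qed.

Lemma dblE a b : Dbl a b = a%:A + b *: dblj.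
Proof. by congr Dbl => /=; ring. Qed.

(* The coordinates of X + Y j = <x, y>. *)
Definition dbl_x u : R := dbl_re u + dbl_j u.
Definition dbl_y u : R := dbl_re u - dbl_j u.

(* The double plane is [dbl R * dbl R]. *)
Definition dbl_dist (p q : dbl R * dbl R) : dbl R :=
  (p.1 - q.1) ^+ 2 + (p.2 - q.2) ^+ 2.

Lemma dbl_dist_x p q :
  dbl_x (dbl_dist p q) =
  (dbl_x p.1 - dbl_x q.1) ^+ 2 + (dbl_x p.2 - dbl_x q.2) ^+ 2.
Proof. by rewrite /dbl_dist !expr2 /dbl_x /=; ring. Qed.

Lemma dbl_dist_y p q :
  dbl_y (dbl_dist p q) =
  (dbl_y p.1 - dbl_y q.1) ^+ 2 + (dbl_y p.2 - dbl_y q.2) ^+ 2.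
Proof. by rewrite /dbl_dist !expr2 /dbl_y /=; ring. Qed.

(* The pairs p = q are included, so the distance 0 is counted. *)
Definition num_dist (P : {fset dbl R * dbl R}) : nat :=
  #|` [fset dbl_dist p q | p in P, q in P]|.

End DoubleNumbers.

(* Main.v *)
Require Import Defs.
From HB Require Import structures.
From mathcomp Require Import all_boot all_order all_algebra finmap.
From mathcomp Require Import cyclic reals exp.
From mathcomp Require Import zify ring lra.

Set Implicit Arguments.
Unset Strict Implicit.
Unset Printing Implicit Defensive.

Import Order.TTheory GRing.Theory Num.Theory.

(* In the coordinates <x, y, z, w> take the grid {0, ..., k-1}^4 with k^4 of
   order n: both coordinates of a distance are sums of two squares at most
   N = 2 k^2, so it suffices that there are O(N / sqrt (log N)) of those.
   A positive sum of two squares is e g^2 s with e in {1, 2} and s squarefree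
   with all prime factors 1 mod 4, so one counts the pairs (g, s) with
   g^2 s <= N.  Weighting each pair by log s, the sum of log p over p | s,
   Chebyshev's bound on the primes gives (number of pairs) * log N = O(N S),
   where S is the sum of 1/s over the admissible s <= N.  Finally S^2 is at most
   the sum over n <= N^2 of r(n)/n, where r(n) = sum_(d | n) chi4(d) >= 0
   counts all the divisors of n when n is a product of two admissible s;
   exchanging the sums makes this an alternating sum over odd d with
   decreasing terms, bounded by its first term, the harmonic sum up to N^2. *)

(** * Chebyshev's bound on the product of the primes up to n *)

Lemma prod_primes_dvd (r : seq nat) (m : nat) :
  uniq r -> {in r, forall p, prime p && (p %| m)} -> \prod_(p <- r) p %| m.
Proof.
elim: r => [|p r IHr] /=; first by rewrite big_nil dvd1n.
case/andP=> pNr uniq_r r_dvd; rewrite big_cons Gauss_dvd.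
  have /andP[_ ->] := r_dvd p (mem_head _ _).
  by apply: IHr => // q qr; apply: r_dvd; rewrite in_cons qr orbT.
have /andP[p_pr _] := r_dvd p (mem_head _ _).
rewrite prime_coprime // Euclid_dvd_prod // big_has.
apply/hasPn => q qr.
have /andP[q_pr _] := r_dvd q (mem_behead (s := p :: r) qr).
by rewrite dvdn_prime2 //; apply: contraNneq pNr => ->.
Qed.

(** The coefficients at [m] and [m.+1] are equal, and together they are at most 2^(2m+1). *)
Lemma bin_odd_le (m : nat) : 'C(m.*2.+1, m) <= 4 ^ m.
Proof.
have sumC : \sum_(i < m.*2.+2) 'C(m.*2.+1, i) = 2 ^ m.*2.+1.
  rewrite (expnDn 1 1); apply: eq_bigr => i _.
  by rewrite !exp1n !muln1.
have lt_m : m < m.*2.+2 by lia.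
have lt_m1 : m.+1 < m.*2.+2 by lia.
rewrite (bigD1 (Ordinal lt_m)) //= (bigD1 (Ordinal lt_m1)) /= in sumC; last first.
  by rewrite -val_eqE /=; lia.
have eqC : 'C(m.*2.+1, m.+1) = 'C(m.*2.+1, m).
  by rewrite -bin_sub; [congr binomial; lia | lia].
have pow4 : 4 ^ m = 2 ^ m.*2 by rewrite -mul2n expnM.
move: sumC; rewrite eqC expnS pow4.
by lia.
Qed.

Lemma prime_dvd_fact (p j : nat) : prime p -> (p %| j`!) = (p <= j).
Proof.
move=> p_pr; have p_gt0 := prime_gt0 p_pr.
apply/idP/idP => [|p_le_j]; last by rewrite dvdn_fact // p_gt0.
apply: contraLR; rewrite -ltnNge; elim: j => [|j IHj] j_lt.
  by rewrite fact0 Euclid_dvd1.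
by rewrite factS Euclid_dvdM // negb_or gtnNdvd // IHj // ltnW.
Qed.

(** Erdős' induction: an even number above 2 is not prime; for 2k+1, the primes from k+2 to 2k+1 all
    divide the binomial coefficient of [bin_odd_le], and the induction hypothesis covers those up to
    k+1. *)
Lemma primorial_le (n : nat) : \prod_(1 <= p < n.+1 | prime p) p <= 4 ^ n.
Proof.
have [m] := ubnP n; elim: m n => // m IHm [|n]; first by rewrite big_geq.
rewrite ltnS => n_lt_m.
have [n_odd | n_even] := boolP (odd n.+1); last first.
  have [n1|n_gt1] := leqP n 1.
    case: n n1 n_even {n_lt_m} => [|[|n]] // _ _.
    by rewrite unlock.
  rewrite big_mkcond big_nat_recr //= -big_mkcond /= ifF.
    by rewrite muln1 (leq_trans (IHm n _)) // leq_exp2l.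
  apply/negP => n_pr; case: (even_prime n_pr) => [|n_odd]; first by lia.
  by rewrite n_odd in n_even.
have [k nE] : exists k, n = k.*2 by exists n./2; move: n_odd => /=; lia.
have [k0|k_gt0] := posnP k.
  by rewrite nE k0 unlock.
rewrite nE (big_cat_nat (n := k.+2)) //=; last by lia.
have pow4 : 4 ^ k.*2.+1 = 4 ^ k.+1 * 4 ^ k by rewrite -expnD; congr expn; lia.
have le1 : \prod_(1 <= p < k.+2 | prime p) p <= 4 ^ k.+1 by apply: IHm; lia.
have le2 : \prod_(k.+2 <= p < k.*2.+2 | prime p) p <= 'C(k.*2.+1, k).
  apply: dvdn_leq; first by rewrite bin_gt0; lia.
  rewrite -big_filter; apply: prod_primes_dvd.
    by rewrite filter_uniq ?iota_uniq.
  move=> p; rewrite mem_filter mem_index_iota => /and3P[p_pr pk pk2].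
  rewrite p_pr /=.
  have le_k : k <= k.*2.+1 by lia.
  have : p %| (k.*2.+1)`! by rewrite prime_dvd_fact //; lia.
  rewrite -(bin_fact le_k) !Euclid_dvdM // !prime_dvd_fact //.
  by case/orP=> // ; lia.
by rewrite pow4 leq_mul // (leq_trans le2) // bin_odd_le.
Qed.

(** * The shape of sums of two squares *)

Definition sqfree1mod4 (s : nat) : bool :=
  (0 < s) && all (fun p => (p %% 4 == 1) && (logn p s == 1)) (primes s).

Lemma sqfree1mod4_divr (p t : nat) :
  prime p -> sqfree1mod4 (p * t) -> sqfree1mod4 t.
Proof.
move=> p_pr /andP[]; rewrite muln_gt0 => /andP[p0 t0] /allP pt_ok.
rewrite /sqfree1mod4 t0; apply/allP => q qt.
have /andP[-> /eqP] : (q %% 4 == 1) && (logn q (p * t) == 1).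
  by apply: pt_ok; rewrite primesM // qt orbT.
rewrite lognM // /= => logq1.
by move: qt; rewrite -logn_gt0; lia.
Qed.

Lemma dvdn_1mod4 (n d : nat) : 0 < n ->
  {in primes n, forall p, p %% 4 = 1} -> d %| n -> d %% 4 = 1.
Proof.
move=> n_gt0 n_ok d_n; have d_gt0 := dvdn_gt0 n_gt0 d_n.
rewrite (prod_prime_decomp d_gt0) prime_decompE big_map /= big_seq.
elim/big_ind: _ => //= [x y x1 y1|p]; first by rewrite -modnMm x1 y1.
rewrite mem_primes => /and3P[p_pr _ p_d].
by rewrite -modnXm (n_ok p) ?exp1n // mem_primes p_pr n_gt0 (dvdn_trans p_d).
Qed.

(** This makes the character modulo 4 equal to 1 on every divisor of [s * t], so that its divisor
    sum counts them all. *)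
Lemma sqfree1mod4_mul_dvd (s t d : nat) :
  sqfree1mod4 s -> sqfree1mod4 t -> d %| s * t -> d %% 4 = 1.
Proof.
move=> /andP[s0 /allP s_ok] /andP[t0 /allP t_ok].
apply: dvdn_1mod4; first by rewrite muln_gt0 s0.
by move=> p; rewrite primesM // => /orP[/s_ok|/t_ok] /andP[/eqP].
Qed.

(** Otherwise b^2 = -a^2 modulo p; raising to the odd power (p-1)/2 turns this into 1 = -1 by
    Fermat, although p > 2. *)
Lemma prime_3mod4_sum_sqr (p a b : nat) :
  prime p -> p %% 4 = 3 -> p %| a ^ 2 + b ^ 2 -> (p %| a) && (p %| b).
Proof.
move=> p_pr p3 p_ab.
have p_a : p %| a.
  apply/negPn/negP => pNa.
  have pNb : ~~ (p %| b).
    apply: contra pNa => p_b; move: p_ab.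
    by rewrite dvdn_addl ?Euclid_dvdX ?p_b // => /andP[].
  have [k pE] : exists k, p = 4 * k + 3 by exists (p %/ 4); lia.
  have fermat c : ~~ (p %| c) -> c ^ (4 * k + 2) = 1 %[mod p].
    move=> pNc; have -> : 4 * k + 2 = totient p
      by rewrite totient_prime // pE addn3 addn2.
    by apply: Euler_exp_totient; rewrite coprime_sym prime_coprime.
  (* Adding a^2 b^2 makes either side a multiple of a^2 + b^2, which avoids negative numbers. *)
  have eq4 : (b ^ 2) ^ 2 = (a ^ 2) ^ 2 %[mod p].
    move: (a ^ 2) (b ^ 2) p_ab => x y /eqP p_xy.
    apply/eqP; rewrite -(eqn_modDr (x * y)) -!mulnn -mulnDl -mulnDr.
    by rewrite addnC -modnMml -[X in _ == X]modnMmr p_xy muln0 mul0n.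
  have pow c : c ^ 2 * ((c ^ 2) ^ 2) ^ k = c ^ (4 * k + 2).
    by rewrite -!expnM -expnD addnC ?mulnA.
  have powb : b ^ 2 * ((a ^ 2) ^ 2) ^ k = b ^ (4 * k + 2) %[mod p].
    by rewrite -modnMmr -modnXm -eq4 modnXm modnMmr pow.
  have : p %| (a ^ 2 + b ^ 2) * ((a ^ 2) ^ 2) ^ k by rewrite dvdn_mulr.
  rewrite mulnDl pow /dvdn -modnDm powb !fermat // modnDm.
  by rewrite modn_small // pE addn3.
rewrite p_a /=; move: p_ab.
by rewrite dvdn_addr ?Euclid_dvdX ?p_a // => /andP[].
Qed.

Lemma sqfree_decomp (m : nat) : 0 < m ->
  exists h s, m = h ^ 2 * s /\ forall p, prime p -> p %| s -> logn p s = 1.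
Proof.
have [n] := ubnP m; elim: n m => // n IHn m; rewrite ltnS => m_le m0.
have [m_sqf | ] := boolP (all (fun p => logn p m == 1) (primes m)).
  exists 1, m; rewrite mul1n; split=> // p p_pr p_m.
  by apply/eqP/(allP m_sqf); rewrite mem_primes p_pr m0.
case/allPn => p; rewrite mem_primes => /and3P[p_pr _ p_m] logm.
have : p ^ 2 %| m.
  rewrite pfactor_dvdn //; move: logm.
  have : 0 < logn p m by rewrite logn_gt0 mem_primes p_pr m0.
  by case: (logn p m) => [|[]].
case/dvdnP=> m' mE.
have p2 := prime_gt1 p_pr.
have m'0 : 0 < m' by move: m0; rewrite mE muln_gt0 => /andP[].
have [||h [s [m'E s_ok]]] := IHn m'; [nia|by []|].
by exists (p * h), s; split=> //; rewrite mE m'E expnMn; lia.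
Qed.

(** After division by the gcd, no prime 3 mod 4 divides the sum, by [prime_3mod4_sum_sqr]. Its
    largest square factor joins [g]; the squarefree rest contains 2 at most once, and [e] records
    whether it does. *)
Lemma sum_sqr_decomp (a b : nat) : 0 < a ^ 2 + b ^ 2 ->
  exists e g s, [/\ a ^ 2 + b ^ 2 = e * (g ^ 2 * s), (e == 1) || (e == 2),
                    0 < g & sqfree1mod4 s].
Proof.
move=> ab0; set g := gcdn a b.
have g0 : 0 < g by rewrite gcdn_gt0; case: a b ab0 {g} => [|a] [|b].
have [a' aE] := dvdnP (dvdn_gcdl a b); have [b' bE] := dvdnP (dvdn_gcdr a b).
rewrite -/g in aE bE.
have co_ab : coprime a' b'.
  by rewrite /coprime -(eqn_pmul2r g0) mul1n muln_gcdl -aE -bE.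
have abE : a ^ 2 + b ^ 2 = g ^ 2 * (a' ^ 2 + b' ^ 2) by rewrite aE bE !expnMn; lia.
have ab'0 : 0 < a' ^ 2 + b' ^ 2 by move: ab0; rewrite abE muln_gt0 => /andP[].
have [h [s [abE' s_sqf]]] := sqfree_decomp ab'0.
have h0 : 0 < h by move: ab'0; rewrite abE' muln_gt0 expn_gt0 orbF => /andP[].
have s0 : 0 < s by move: ab'0; rewrite abE' muln_gt0 => /andP[].
have s_pr p : prime p -> p %| s -> p %% 4 != 3.
  move=> p_pr p_s; apply/eqP => p3.
  have /andP[p_a' p_b'] : (p %| a') && (p %| b').
    by apply: prime_3mod4_sum_sqr => //; rewrite abE' dvdn_mull.
  have : p %| gcdn a' b' by rewrite dvdn_gcd p_a'.
  by rewrite (eqP co_ab) Euclid_dvd1.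
have [e [t [sE e12 t_odd]]] :
    exists e t, [/\ s = e * t, (e == 1) || (e == 2) & odd t].
  have [s_odd|s_even] := boolP (odd s); first by exists 1, s; rewrite mul1n.
  exists 2, s./2; split=> //; first by lia.
  have := s_sqf 2 isT; rewrite dvdn2 => /(_ s_even).
  rewrite {1}(_ : s = 2 * s./2); last by lia.
  rewrite lognM //; last by lia.
  rewrite /= => -[]/eqP; apply: contraTT => t_even.
  by rewrite -lt0n logn_gt0 mem_primes /= dvdn2 t_even; lia.
exists e, (g * h), t; split=> //.
- by rewrite abE abE' sE expnMn; lia.
- by rewrite muln_gt0 g0.
have t0 : 0 < t by case: (t) t_odd.
rewrite /sqfree1mod4 t0; apply/allP => p; rewrite mem_primes => /and3P[p_pr _ p_t].
have p_s : p %| s by rewrite sE dvdn_mull.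
have p_odd : odd p by apply: dvdn_odd t_odd.
have := s_pr p p_pr p_s; have := s_sqf p p_pr p_s.
have e0 : 0 < e by case/orP: e12 => /eqP->.
have : 0 < logn p t by rewrite logn_gt0 mem_primes p_pr t0.
by rewrite sE lognM //; clear -p_odd; lia.
Qed.

Local Open Scope ring_scope.

(** * Divisor sums and the character modulo 4 *)

Lemma big_dirichlet (V : nmodType) (N : nat) (F : nat -> nat -> V) :
  \sum_(1 <= n < N.+1) \sum_(1 <= d < n.+1 | (d %| n)%N) F d (n %/ d)%N =
  \sum_(1 <= d < N.+1) \sum_(1 <= e < N.+1 | (d * e <= N)%N) F d e.
Proof.
(* Both sides collapse this triple sum over n = d e: one by solving for e, the other by summing over
   n first. *)
transitivity (\sum_(1 <= n < N.+1) \sum_(1 <= d < N.+1)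
    \sum_(1 <= e < N.+1 | n == (d * e)%N) F d e).
  rewrite !big_nat; apply: eq_bigr => n /andP[n_gt0 n_le].
  rewrite (@big_nat_widen _ _ _ 1 n.+1 N.+1) // big_mkcond.
  rewrite !big_nat; apply: eq_bigr => d /andP[d_gt0 d_le].
  have [/dvdnP[q nE]|dNn] := boolP (d %| n)%N; last first.
    rewrite big1 // => e /eqP nE.
    by rewrite nE dvdn_mulr in dNn.
  rewrite nE in n_gt0 n_le *.
  have dq : (d <= q * d)%N.
    by case: q n_gt0 {nE n_le} => // q _; rewrite mulSn leq_addr.
  rewrite ltnS dq /= mulnK //.
  rewrite (eq_bigl (fun e => e == q)); last first.
    by move=> e; rewrite mulnC eqn_pmul2l // eq_sym.
  rewrite big_nat1_eq ifT //.
  have : (0 < q)%N by case: q n_gt0 {nE n_le dq}.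
  by move=> ->; nia.
rewrite exchange_big_nat /= !big_nat; apply: eq_bigr => d /andP[d_gt0 _].
rewrite (exchange_big_dep_nat xpredT) //= [RHS]big_mkcond /=.
rewrite !big_nat; apply: eq_bigr => e /andP[e_gt0 _].
by rewrite big_nat1_eq ltnS muln_gt0 d_gt0 e_gt0.
Qed.

(** The nonprincipal Dirichlet character modulo 4. *)
Definition chi4 (R : pzRingType) (n : nat) : R :=
  (n %% 4 == 1)%N%:R - (n %% 4 == 3)%N%:R.

Section Chi4.
Variable R : realType.
Local Notation chi4 := (chi4 R).

Lemma chi4M m n : chi4 (m * n)%N = chi4 m * chi4 n.
Proof.
rewrite /chi4 -modnMm.
have := ltn_pmod m (isT : 0 < 4)%N; have := ltn_pmod n (isT : 0 < 4)%N.
by case: (m %% 4)%N (n %% 4)%N => [|[|[|[|//]]]] [|[|[|[|//]]]] _ _ /=;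
  rewrite ?(mulr0, mul0r, subrr, subr0, sub0r, mulr1, mulrNN, mul1r, mulrN).
Qed.

Lemma chi4_cases n : [\/ chi4 n = 0, chi4 n = 1 | chi4 n = -1].
Proof.
rewrite /chi4; have := ltn_pmod n (isT : 0 < 4)%N.
by case: (n %% 4)%N => [|[|[|[|//]]]] _ /=; rewrite ?(subrr, subr0, sub0r);
  [constructor 1|constructor 2|constructor 1|constructor 3].
Qed.

(** A divisor prime to p divides m; any other is p times a divisor of p^k m. *)
Lemma sum_divisors_pexpS (f : nat -> R) p k m : prime p -> ~~ (p %| m)%N ->
  \sum_(d <- divisors (p ^ k.+1 * m)) f d =
  \sum_(d <- divisors m) f d + \sum_(d <- divisors (p ^ k * m)) f (p * d)%N.
Proof.
move=> p_pr pNm; have p0 := prime_gt0 p_pr.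
have m0 : (0 < m)%N by case: m pNm => //; rewrite dvdn0.
have pk0 j : (0 < p ^ j * m)%N by rewrite muln_gt0 expn_gt0 p0.
rewrite -(big_map (muln p) xpredT f) -big_cat; apply: perm_big.
apply: uniq_perm; first exact: divisors_uniq.
  rewrite cat_uniq divisors_uniq map_inj_uniq ?divisors_uniq ?andbT /=; last first.
    by move=> x y /eqP; rewrite eqn_pmul2l // => /eqP.
  apply/hasPn => _ /mapP[d _ ->]; rewrite /= -dvdn_divisors //.
  by apply: contra pNm; apply: dvdn_trans; rewrite dvdn_mulr.
move=> d; rewrite mem_cat -!dvdn_divisors //.
have [/dvdnP[e ->]|pNd] := boolP (p %| d)%N.
  rewrite mulnC mem_map; last by move=> x y /eqP; rewrite eqn_pmul2l // => /eqP.
  rewrite expnS -mulnA dvdn_pmul2l // -dvdn_divisors //.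
  rewrite (_ : (p * e %| m)%N = false) //; apply: contraNF pNm.
  by apply: dvdn_trans; rewrite dvdn_mulr.
rewrite Gauss_dvdr; last by rewrite coprimeXr // coprime_sym prime_coprime.
rewrite (_ : (d \in map _ _) = false) ?orbF //.
by apply: contraNF pNd => /mapP[e _ ->]; rewrite dvdn_mulr.
Qed.

(** Write n = p^k m with p the least prime factor. The divisor sums S j of p^j m satisfy S (j+1) = S
    0 + chi4 p * S j, and S 0 >= 0 by induction. *)
Lemma sum_chi4_divisors_ge0 n : (0 < n)%N -> 0 <= \sum_(d <- divisors n) chi4 d.
Proof.
have [b] := ubnP n; elim: b n => // b IHb n; rewrite ltnS => n_le n0.
have [n_le1|n_gt1] := leqP n 1.
  have -> : n = 1%N by lia.
  by rewrite big_cons big_nil /chi4 /= subr0 addr0 ler01.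
have p_pr := pdiv_prime n_gt1; set p := pdiv n in p_pr.
have [m pNm nE] := pfactor_coprime p_pr n0.
rewrite prime_coprime // in pNm.
have k0 : (0 < logn p n)%N by rewrite logn_gt0 mem_primes p_pr n0 pdiv_dvd.
have m0 : (0 < m)%N by move: n0; rewrite nE muln_gt0 => /andP[].
have p2 := prime_gt1 p_pr.
have m_ge0 : 0 <= \sum_(d <- divisors m) chi4 d.
  apply: IHb => //; apply: leq_trans n_le; rewrite [ltnRHS]nE.
  by rewrite ltn_Pmulr // -[1%N](expn0 p) ltn_exp2l.
rewrite nE mulnC {k0 nE}; move: (logn p n) => k.
set S := fun k => \sum_(d <- divisors (p ^ k * m)) chi4 d.
have SS j : S j.+1 = S 0%N + chi4 p * S j.
  rewrite /S sum_divisors_pexpS // expn0 mul1n mulr_sumr.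
  by congr (_ + _); apply: eq_bigr => d _; rewrite chi4M.
have S0 : 0 <= S 0%N by rewrite /S expn0 mul1n.
(* If chi4 p = -1, then S alternates between S 0 and 0, which the second
   conjunct records. *)
suff /andP[] : (0 <= S k) && ((chi4 p == -1) ==> (S k <= S 0%N)) by [].
elim: k => [|k /andP[IH1 IH2]]; first by rewrite S0 lexx implybT.
rewrite SS; have [p_chi|p_chi|p_chi] := chi4_cases p; rewrite p_chi in IH2 *.
- by rewrite mul0r addr0 S0 lexx implybT.
- by rewrite mul1r addr_ge0 //= gt_eqF //; lra.
by rewrite eqxx /= in IH2 *; rewrite mulN1r subr_ge0 IH2 gerBl.
Qed.

Lemma sum_chi4_le (f : nat -> R) N : (forall d, 0 <= f d) ->
  (forall d, (0 < d)%N -> f (d + 2)%N <= f d) ->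
  \sum_(1 <= d < N.+1) chi4 d * f d <= f 1%N.
Proof.
move=> f_ge0 f_dec.
have chi_2 k : chi4 (4 * k + 2)%N = 0 by rewrite /chi4 mulnC modnMDl subrr.
have chi_3 k : chi4 (4 * k + 2).+1%N = -1.
  by rewrite -addnS /chi4 mulnC modnMDl sub0r.
have chi_4 k : chi4 (4 * k + 2).+2%N = 0.
  by rewrite -!addnS /chi4 mulnC modnMDl subrr.
have chi_5 k : chi4 (4 * k + 2).+3%N = 1.
  by rewrite -!addnS /chi4 mulnC modnMDl subr0.
(* Cut just after a term of sign +1: each further block of four adds -f(4k+3) + f(4k+5) <= 0. The at
   most three terms left over below contribute 0, -f(4k+3), 0. *)
have main k : \sum_(1 <= d < (4 * k + 2)%N) chi4 d * f d <= f 1%N.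
  elim: k => [|k IHk]; first by rewrite big_nat1 /chi4 /= subr0 mul1r.
  have -> : (4 * k.+1 + 2 = (4 * k + 2).+4)%N by lia.
  rewrite !big_nat_recr /= ?addn2 // -addn2 chi_2 chi_3 chi_4 chi_5.
  have := f_dec (4 * k + 2).+1 isT; rewrite addn2; lra.
have [N0|N_gt0] := posnP N; first by rewrite N0 big_geq.
have [k [r [NE r_lt]]] : exists k r, (N.+1 = 4 * k + 2 + r /\ r < 4)%N.
  by exists (N.-1 %/ 4)%N, (N.-1 %% 4)%N; lia.
have f3 := f_ge0 (4 * k + 2).+1.
have le1 : (1 <= 4 * k + 2)%N by rewrite addn2.
rewrite NE; case: r r_lt {NE} => [|[|[|[|//]]]] _.
- by rewrite addn0.
- by rewrite addn1 big_nat_recr //= chi_2 mul0r addr0.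
- rewrite addn2 !big_nat_recr ?leqW //= chi_2 chi_3 mul0r addr0 mulN1r.
  by rewrite (le_trans _ (main k)) // gerBl.
rewrite addn3 !big_nat_recr ?leqW //= chi_2 chi_3 chi_4 !mul0r !addr0 mulN1r.
by rewrite (le_trans _ (main k)) // gerBl.
Qed.
End Chi4.

(** * Sums of reciprocals and of logarithms *)

Section Sums.
Variable R : realType.
Local Notation chi4 := (chi4 R).

Lemma big_divisors (f : nat -> R) n : (0 < n)%N ->
  \sum_(d <- divisors n) f d = \sum_(1 <= d < n.+1 | (d %| n)%N) f d.
Proof.
move=> n0; rewrite -[RHS]big_filter; apply: perm_big; apply: uniq_perm.
- exact: divisors_uniq.
- by rewrite filter_uniq ?iota_uniq.
move=> d; rewrite mem_filter mem_index_iota -dvdn_divisors // ltnS.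
have [d_n|//] := boolP (d %| n)%N.
by rewrite (dvdn_gt0 n0 d_n) (dvdn_leq n0 d_n).
Qed.

Lemma harmonic_le_ln (n : nat) : (0 < n)%N ->
  \sum_(1 <= k < n.+1) k%:R^-1 <= 1 + ln n%:R :> R.
Proof.
case: n => // n _; elim: n => [|n IHn].
  by rewrite big_nat1 invr1 ln1 addr0.
rewrite big_nat_recr //=.
have n1 : 0 < n.+1%:R :> R by rewrite ltr0n.
have n2 : 0 < n.+2%:R :> R by rewrite ltr0n.
suff : ln (n.+1%:R / n.+2%:R) <= - n.+2%:R^-1 :> R.
  rewrite ln_div ?posrE // => ln_le.
  apply: le_trans (lerD IHn (lexx _)) _; rewrite -addrA lerD2l.
  by rewrite -lerBrDl -opprB lerNr.
have -> : n.+1%:R / n.+2%:R = 1 + - n.+2%:R^-1 :> R.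
  rewrite -[n.+2%:R]natr1; set x := n.+1%:R in n1 *.
  by field; apply: lt0r_neq0; lra.
by apply: le_ln1Dx; rewrite ltrN2 invf_lt1 ?ltr1n.
Qed.

(** Exchanging the sums gives [chi4 d] weighted by the sum [f d] of 1/(de) over e <= N/d. Both the
    range and the terms shrink as d grows, so [sum_chi4_le] leaves only [f 1], the harmonic sum. *)
Lemma sum_inv_chi4_divisors_le (N : nat) :
  \sum_(1 <= n < N.+1) n%:R^-1 * \sum_(d <- divisors n) chi4 d <=
  \sum_(1 <= e < N.+1) e%:R^-1.
Proof.
pose f d : R := \sum_(1 <= e < N.+1 | (d * e <= N)%N) (d * e)%:R^-1.
rewrite (_ : \sum_(_ <= n < _) _ = \sum_(1 <= d < N.+1) chi4 d * f d); last first.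
  under [RHS]eq_bigr do rewrite mulr_sumr.
  rewrite -(big_dirichlet N (fun d e => chi4 d * (d * e)%:R^-1)).
  rewrite !big_nat; apply: eq_bigr => n /andP[n0 _].
  rewrite big_divisors // mulr_sumr; apply: eq_bigr => d d_n.
  by rewrite mulrC mulnC divnK.
apply: le_trans (sum_chi4_le N _ _) _.
- by move=> d; apply: sumr_ge0 => e _; rewrite invr_ge0.
- move=> d d0; rewrite /f big_mkcond [leRHS]big_mkcond /=.
  rewrite !big_nat; apply: ler_sum => e /andP[e0 _].
  case: ifP => [de_le|_]; last by case: ifP; rewrite // invr_ge0.
  rewrite ifT; last by apply: leq_trans de_le; rewrite leq_mul2r leq_addr orbT.
  rewrite lef_pV2 ?posrE ?ltr0n ?muln_gt0 ?d0 ?e0 ?addn2 //.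
  by rewrite ler_nat leq_mul2r -addn2 leq_addr orbT.
rewrite /f big_mkcond /= !big_nat; apply: ler_sum => e /andP[_ e_le].
by rewrite mul1n -ltnS e_le.
Qed.

Lemma sum_inv_sqfree1mod4_sqr_le (N : nat) :
  (\sum_(1 <= s < N.+1 | sqfree1mod4 s) s%:R^-1) ^+ 2 <=
  \sum_(1 <= e < (N ^ 2).+1) e%:R^-1 :> R.
Proof.
pose g d e : R := if sqfree1mod4 d && sqfree1mod4 e then (d * e)%:R^-1 else 0.
have g_ge0 d e : 0 <= g d e by rewrite /g; case: ifP; rewrite // invr_ge0.
apply: le_trans (sum_inv_chi4_divisors_le (N ^ 2)).
apply: (@le_trans _ _ (\sum_(1 <= d < (N ^ 2).+1)
    \sum_(1 <= e < (N ^ 2).+1 | (d * e <= N ^ 2)%N) g d e)).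
  have N_le : (N < (N ^ 2).+1)%N.
    by rewrite ltnS; case: (N) => // n; rewrite -mulnn leq_pmulr.
  rewrite expr2 big_distrlr /= (@big_nat_widen _ _ _ 1 N.+1 (N ^ 2).+1) //=.
  rewrite big_mkcond !big_nat; apply: ler_sum => d _.
  case: ifP => [/andP[d_ok d_le]|_]; last first.
    by apply: sumr_ge0.
  rewrite (@big_nat_widen _ _ _ 1 N.+1 (N ^ 2).+1) //=.
  rewrite big_mkcond [leRHS]big_mkcond; apply: ler_sum => e _.
  case: ifP => [/andP[e_ok e_le]|_]; last by case: ifP.
  by rewrite -mulnn leq_mul // /g d_ok e_ok natrM invfM.
rewrite -big_dirichlet !big_nat; apply: ler_sum => n /andP[n0 _].
(* If n is a product of two admissible numbers, every divisor has [chi4] equal to 1 and the terms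
   compare one by one. Otherwise the left side is 0 and the right side is nonnegative. *)
have [|none] := boolP (has (fun d => (d %| n)%N && sqfree1mod4 d &&
                                  sqfree1mod4 (n %/ d)) (divisors n)).
  case/hasP=> c _ /andP[/andP[c_n c_ok] nc_ok].
  rewrite big_divisors // mulr_sumr; apply: ler_sum => d d_n.
  rewrite /g mulnC divnK //.
  have -> : chi4 d = 1.
    by rewrite /chi4 (sqfree1mod4_mul_dvd c_ok nc_ok) ?subr0 // mulnC divnK.
  by rewrite mulr1; case: ifP; rewrite // invr_ge0.
rewrite big1 ?mulr_ge0 ?invr_ge0 ?sum_chi4_divisors_ge0 // => d d_n.
have := hasPn none d; rewrite -dvdn_divisors // => /(_ d_n).
by rewrite d_n /= /g => /negPf ->.
Qed.

Lemma ln_prod_nat (I : Type) (r : seq I) (P : pred I) (f : I -> nat) :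
  (forall i, P i -> (0 < f i)%N) ->
  ln (\prod_(i <- r | P i) f i)%:R = \sum_(i <- r | P i) ln (f i)%:R :> R.
Proof.
move=> f_gt0; elim: r => [|i r IHr]; first by rewrite !big_nil ln1.
rewrite !big_cons; case: ifP => // Pi.
by rewrite natrM lnM ?IHr // posrE ltr0n ?f_gt0 // prodn_cond_gt0.
Qed.

Lemma chebyshev_theta_le (n : nat) :
  \sum_(1 <= p < n.+1 | prime p) ln p%:R <= n%:R * ln 4 :> R.
Proof.
rewrite -(@ln_prod_nat _ _ _ id); last exact: prime_gt0.
rewrite mulr_natl -lnXn // -natrX ler_ln ?posrE ?ltr0n ?expn_gt0 //.
  by rewrite ler_nat primorial_le.
by rewrite prodn_cond_gt0 // => p /prime_gt0.
Qed.

(** Squarefreeness makes s the product of its primes. The sum runs over all divisors, with value 0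
    off the primes, to fit [big_dirichlet]. *)
Lemma ln_sqfree1mod4 (s : nat) : sqfree1mod4 s ->
  ln s%:R = \sum_(1 <= p < s.+1 | (p %| s)%N) if prime p then ln p%:R else 0 :> R.
Proof.
move=> /andP[s0 /allP s_ok].
have sE : s = (\prod_(p <- primes s) p)%N.
  rewrite {1}(prod_prime_decomp s0) prime_decompE big_map /= !big_seq.
  by apply: eq_bigr => p /s_ok /andP[_ /eqP ->].
rewrite {1}sE big_seq ln_prod_nat -?big_seq; last first.
  by move=> p; rewrite mem_primes => /andP[/prime_gt0].
rewrite -big_divisors // -big_mkcond -[RHS]big_filter; apply: perm_big.
apply: uniq_perm; rewrite ?primes_uniq ?filter_uniq ?divisors_uniq // => p.
by rewrite mem_filter -dvdn_divisors // mem_primes s0.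
Qed.

Lemma sum_odd_le (u : R) (n : nat) : 0 <= u ->
  \sum_(1 <= g < n.+1 | (g ^ 2)%:R <= u) (2 * g%:R - 1) <= u.
Proof.
move=> u0.
suff : \sum_(1 <= g < n.+1 | (g ^ 2)%:R <= u) (2 * g%:R - 1)
    <= Num.min u (n ^ 2)%:R.
  by rewrite le_min => /andP[].
elim: n => [|n IHn]; first by rewrite big_geq // le_min u0 /=.
rewrite big_mkcond big_nat_recr //= -big_mkcond /=.
move: IHn; rewrite !le_min => /andP[IH1 IH2].
rewrite !natrX -natr1 in IH2 *.
case: ifP => [n_le|_].
  by apply/andP; split; lra.
by rewrite addr0 IH1 /=; have := ler0n R n; lra.
Qed.

Lemma sum_inv_sqr_le2 (n : nat) : \sum_(1 <= g < n.+1) (g ^ 2)%:R^-1 <= 2 :> R.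
Proof.
case: n => [|n]; first by rewrite big_geq.
suff : \sum_(1 <= g < n.+2) (g ^ 2)%:R^-1 <= 2 - n.+1%:R^-1 :> R.
  by move=> /le_trans; apply; rewrite gerBl invr_ge0.
elim: n => [|n IHn]; first by rewrite big_nat1 invr1; lra.
rewrite big_nat_recr //=.
have n1 : 0 < n.+1%:R :> R by rewrite ltr0n.
apply: le_trans (lerD IHn (lexx _)) _.
rewrite natrX -[n.+2%:R]natr1; set x := n.+1%:R in n1 *.
(* Telescoping, with 1/(x+1)^2 <= 1/(x(x+1)). *)
have -> : 2 - (x + 1)^-1 = 2 - x^-1 + (x * (x + 1))^-1.
  by field; apply/andP; split; apply: lt0r_neq0; lra.
rewrite lerD2l lef_pV2 ?posrE; nra.
Qed.
End Sums.

(** * Counting the pairs (g, s) with g^2 s at most N *)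

Section Count.
Variable R : realType.

Definition sqr_sqfree_pairs (N : nat) : seq (nat * nat) :=
  [seq gs <- [seq (g, s) | g <- index_iota 1 N.+1, s <- index_iota 1 N.+1] |
     (gs.1 ^ 2 * gs.2 <= N)%N && sqfree1mod4 gs.2].

Lemma ln_le_subr1 (x : R) : 0 < x -> ln x <= x - 1.
Proof.
by move=> x0; rewrite -{1}[x](addrNK 1) addrC; apply: le_ln1Dx; lra.
Qed.

Lemma chebyshev_theta_div_le (N c : nat) : (0 < c)%N ->
  \sum_(1 <= p < N.+1 | (p * c <= N)%N) (if prime p then ln p%:R else 0)
    <= (N%:R / c%:R) * ln 4 :> R.
Proof.
move=> c0; rewrite -big_mkcondr /=.
have -> : \sum_(1 <= p < N.+1 | (p * c <= N)%N && prime p) ln p%:R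
  = \sum_(1 <= p < (N %/ c).+1 | prime p) ln p%:R :> R.
  rewrite [RHS](@big_nat_widen _ _ _ _ _ N.+1) ?ltnS ?leq_div //.
  by apply: eq_bigl => p; rewrite ltnS leq_divRL // andbC.
apply: le_trans (chebyshev_theta_le _ _) _.
rewrite ler_wpM2r ?ln_ge0 ?ler1n // ler_pdivlMr ?ltr0n //.
by rewrite -natrM ler_nat leq_divM.
Qed.

(** Expand ln s over the primes p dividing s and put s = p t. Then t is again admissible, and for
    fixed t Chebyshev bounds the sum of ln p over p <= N/(ct). *)
Lemma sum_ln_sqfree1mod4_le (N c : nat) : (0 < c)%N ->
  \sum_(1 <= s < N.+1 | (c * s <= N)%N && sqfree1mod4 s) ln s%:R
  <= N%:R / c%:R * ln 4 * \sum_(1 <= t < N.+1 | sqfree1mod4 t) t%:R^-1 :> R.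
Proof.
move=> c0.
pose L p : R := if prime p then ln p%:R else 0.
have L_ge0 p : 0 <= L p.
  rewrite /L; case: ifP => // /prime_gt0 p0.
  by rewrite ln_ge0 // ler1n.
pose F p t : R := if (c * (p * t) <= N)%N && sqfree1mod4 (p * t) then L p else 0.
have -> : \sum_(1 <= s < N.+1 | (c * s <= N)%N && sqfree1mod4 s) ln s%:R
  = \sum_(1 <= s < N.+1) \sum_(1 <= p < s.+1 | (p %| s)%N) F p (s %/ p)%N.
  rewrite big_mkcond; apply: eq_bigr => s _.
  case: ifP => [/andP[cs s_ok]|s_nok].
    rewrite ln_sqfree1mod4 //; apply: eq_bigr => p p_s.
    by rewrite /F [(p * _)%N]mulnC divnK // cs s_ok.
  by rewrite big1 // => p p_s; rewrite /F [(p * _)%N]mulnC divnK // s_nok.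
rewrite big_dirichlet.
apply: (@le_trans _ _ (\sum_(1 <= p < N.+1) \sum_(1 <= t < N.+1 | sqfree1mod4 t)
    if (p * (c * t) <= N)%N then L p else 0)).
  apply: ler_sum => p _; rewrite big_mkcond [leRHS]big_mkcond.
  apply: ler_sum => t _; rewrite /F mulnCA.
  case: ifP => _; last by case: ifP => // _; case: ifP.
  case: ifP => [/andP[cpt pt_ok]|_]; last by case: ifP => // _; case: ifP.
  rewrite cpt /L; have [p_pr|_] := boolP (prime p); last by rewrite if_same.
  by rewrite (sqfree1mod4_divr p_pr pt_ok).
rewrite exchange_big_nat mulr_sumr /=.
rewrite big_nat_cond [leRHS]big_nat_cond; apply: ler_sum => t /andP[/andP[t0 _] _].
rewrite -big_mkcond; apply: le_trans (chebyshev_theta_div_le _ _) _.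
  by rewrite muln_gt0 c0.
by rewrite natrM invfM mulrA mulrAC.
Qed.

Lemma sum_sqr_sqfree_pairs (f : nat -> nat -> R) (N : nat) :
  \sum_(gs <- sqr_sqfree_pairs N) f gs.1 gs.2 =
  \sum_(1 <= g < N.+1) \sum_(1 <= s < N.+1 | (g ^ 2 * s <= N)%N && sqfree1mod4 s)
    f g s.
Proof.
rewrite /sqr_sqfree_pairs big_filter big_mkcond big_allpairs /=.
by apply: eq_bigr => g _; rewrite [RHS]big_mkcond.
Qed.

(* For each pair, ln N = ln s + 2 ln g + ln (N / (g ^ 2 * s)), and
   ln x <= x - 1 controls the last two terms. *)
Lemma size_sqr_sqfree_pairs_ln_le (N : nat) :
  (size (sqr_sqfree_pairs N))%:R * ln N%:R
  <= (3 + 2 * ln 4) * N%:R * \sum_(1 <= s < N.+1 | sqfree1mod4 s) s%:R^-1 :> R.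
Proof.
set S := \sum_(_ <= s < _ | _) _.
have ln4_ge0 : 0 <= ln 4 :> R by rewrite ln_ge0 ?ler1n.
have N_ge0 : 0 <= N%:R :> R by [].
have S_ge0 : 0 <= S by apply: sumr_ge0 => s _; rewrite invr_ge0.
rewrite -sum1_size natr_sum mulr_suml.
rewrite (sum_sqr_sqfree_pairs (fun _ _ => 1%:R * ln N%:R)).
(* The logarithm bounds give 2g - 3, weakened to 2g - 1 so that [sum_odd_le] applies. *)
apply: (@le_trans _ _ (\sum_(1 <= g < N.+1)
    \sum_(1 <= s < N.+1 | (g ^ 2 * s <= N)%N && sqfree1mod4 s)
      (ln s%:R + ((2 * g%:R - 1) + N%:R * ((g ^ 2)%:R^-1 * s%:R^-1))))).
  rewrite !big_nat; apply: ler_sum => g /andP[g0 _].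
  rewrite big_nat_cond [leRHS]big_nat_cond.
  apply: ler_sum => s /andP[/andP[s0 _] /andP[gs_le _]].
  have g_gt0 : 0 < g%:R :> R by rewrite ltr0n.
  have s_gt0 : 0 < s%:R :> R by rewrite ltr0n.
  have N_gt0 : 0 < N%:R :> R.
    by rewrite ltr0n (leq_trans _ gs_le) // muln_gt0 expn_gt0 g0.
  have gs_gt0 : 0 < g%:R ^+ 2 * s%:R :> R by rewrite mulr_gt0 // exprn_gt0.
  rewrite mul1r natrX -invfM; set q := _ / _.
  have q_gt0 : 0 < q by rewrite divr_gt0.
  have -> : ln N%:R = ln q + (ln g%:R *+ 2 + ln s%:R) :> R.
    by rewrite -lnXn // -lnM ?posrE ?exprn_gt0 // -lnM ?posrE // divfK ?lt0r_neq0.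
  have := ln_le_subr1 g_gt0; have := ln_le_subr1 q_gt0; lra.
under eq_bigr do rewrite big_split big_split /=.
rewrite big_split big_split /=.
have p1 : \sum_(1 <= g < N.+1)
    \sum_(1 <= s < N.+1 | (g ^ 2 * s <= N)%N && sqfree1mod4 s) ln s%:R
    <= 2 * (N%:R * ln 4 * S).
  apply: (@le_trans _ _ (\sum_(1 <= g < N.+1) (g ^ 2)%:R^-1 * (N%:R * ln 4 * S))).
    rewrite !big_nat; apply: ler_sum => g /andP[g0 _].
    apply: le_trans (sum_ln_sqfree1mod4_le _ _) _; first by rewrite expn_gt0 g0.
    by rewrite !mulrA ler_wpM2r // ler_wpM2r // mulrC.
  by rewrite -mulr_suml ler_wpM2r ?sum_inv_sqr_le2 ?mulr_ge0.
(* Here s is fixed first: the sum over g^2 <= N/s is at most N/s. *)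
have p2 : \sum_(1 <= g < N.+1)
    \sum_(1 <= s < N.+1 | (g ^ 2 * s <= N)%N && sqfree1mod4 s) (2 * g%:R - 1)
    <= N%:R * S :> R.
  rewrite (exchange_big_dep_nat sqfree1mod4) /=; last by move=> g s _ _ _ /andP[].
  rewrite mulr_sumr big_nat_cond [leRHS]big_nat_cond.
  apply: ler_sum => s /andP[/andP[s0 _] s_ok].
  rewrite (eq_bigl (fun g => (g ^ 2)%:R <= N%:R / s%:R :> R)); last first.
    by move=> g; rewrite s_ok andbT ler_pdivlMr ?ltr0n // -natrM ler_nat.
  by apply: sum_odd_le; rewrite divr_ge0.
(* Dropping g^2 s <= N makes the double sum factor. *)
have p3 : \sum_(1 <= g < N.+1)
    \sum_(1 <= s < N.+1 | (g ^ 2 * s <= N)%N && sqfree1mod4 s)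
      N%:R * ((g ^ 2)%:R^-1 * s%:R^-1)
    <= 2 * (N%:R * S) :> R.
  apply: (@le_trans _ _ (\sum_(1 <= g < N.+1) (g ^ 2)%:R^-1 * (N%:R * S))).
    apply: ler_sum => g _; rewrite mulrCA !mulr_sumr.
    rewrite big_mkcond [leRHS]big_mkcond; apply: ler_sum => s _.
    case: ifP => [/andP[_ ->]|_].
      by [].
    by case: ifP => // _; rewrite mulr_ge0 // mulr_ge0 ?invr_ge0.
  by rewrite -mulr_suml ler_wpM2r ?sum_inv_sqr_le2 ?mulr_ge0.
by apply: le_trans (lerD p1 (lerD p2 p3)) _; lra.
Qed.

Lemma ln2_ge_half : 2^-1 <= ln 2 :> R.
Proof.
have : ln (1 + - 2^-1) <= - 2^-1 :> R by apply: le_ln1Dx; lra.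
by rewrite (_ : 1 + - 2^-1 = 2^-1) ?lnV ?posrE //; lra.
Qed.

(** Square the previous bound, insert S^2 <= 1 + 2 ln N <= 4 ln N (the last step by ln N >= 1/2),
    and cancel one factor ln N. *)
Lemma size_sqr_sqfree_pairs_sqr_le (N : nat) : (2 <= N)%N ->
  (size (sqr_sqfree_pairs N))%:R ^+ 2 * ln N%:R
  <= (2 * (3 + 2 * ln 4) * N%:R) ^+ 2 :> R.
Proof.
move=> N2; have N0 : (0 < N)%N by apply: ltnW.
set M := (size _)%:R; set c := 3 + _.
set S : R := \sum_(1 <= s < N.+1 | sqfree1mod4 s) s%:R^-1.
have c_ge0 : 0 <= c by rewrite addr_ge0 // mulr_ge0 // ln_ge0 ?ler1n.
have MlnN : M * ln N%:R <= c * N%:R * S := size_sqr_sqfree_pairs_ln_le N.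
have lnN : 2^-1 <= ln N%:R :> R.
  apply: le_trans ln2_ge_half _.
  by rewrite ler_ln ?posrE ?ltr0n // (ler_nat _ 2).
have lnN_gt0 : 0 < ln N%:R :> R by lra.
have S_le : S ^+ 2 <= 4 * ln N%:R.
  apply: le_trans (sum_inv_sqfree1mod4_sqr_le _ _) _.
  apply: le_trans (harmonic_le_ln _ _) _; first by rewrite expn_gt0 N0.
  by rewrite natrX lnXn ?ltr0n //; lra.
rewrite -(ler_pM2r lnN_gt0).
have : (M * ln N%:R) ^+ 2 <= (c * N%:R * S) ^+ 2.
  have MlnN_ge0 : 0 <= M * ln N%:R by rewrite mulr_ge0 // ltW.
  by rewrite ler_sqr ?nnegrE // (le_trans MlnN_ge0).
have : (c * N%:R) ^+ 2 * S ^+ 2 <= (c * N%:R) ^+ 2 * (4 * ln N%:R).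
  by rewrite ler_wpM2l // sqr_ge0.
by rewrite !exprMn; lra.
Qed.
End Count.

(** * From pairs back to sums of two squares *)

Definition sums_of_squares (k : nat) : seq nat :=
  undup [seq (a ^ 2 + b ^ 2)%N | a <- iota 0 k, b <- iota 0 k].

Lemma size_sums_of_squares_le (k : nat) :
  (size (sums_of_squares k) <= 1 + 2 * size (sqr_sqfree_pairs (2 * k ^ 2)))%N.
Proof.
pose L := [seq (gs.1 ^ 2 * gs.2)%N | gs <- sqr_sqfree_pairs (2 * k ^ 2)].
(* The three pieces are the sum 0 and the cases e = 1 and e = 2 of [sum_sqr_decomp]. *)
apply: (@leq_trans (size (0%N :: L ++ map (muln 2) L))); last first.
  by rewrite /= size_cat /L !size_map addnn -mul2n add1n.
apply: uniq_leq_size; first exact: undup_uniq.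
move=> m; rewrite mem_undup => /allpairsP[[a b] /= []].
rewrite !mem_iota /= !add0n => a_lt b_lt ->.
rewrite in_cons; case: posnP => // ab0 /=.
have [e [g [s [abE e12 g0 s_ok]]]] := sum_sqr_decomp ab0.
have s0 : (0 < s)%N by case/andP: s_ok.
have ab_le : (a ^ 2 + b ^ 2 <= 2 * k ^ 2)%N.
  by rewrite mul2n -addnn leq_add // leq_exp2r // ltnW.
have gs_le : (g ^ 2 * s <= 2 * k ^ 2)%N.
  by apply: leq_trans ab_le; rewrite abE; case/orP: e12 => /eqP ->; lia.
have g_le : (g <= g ^ 2 * s)%N by rewrite -mulnn -mulnA leq_pmulr // muln_gt0 g0.
have s_le : (s <= g ^ 2 * s)%N by rewrite leq_pmull // expn_gt0 g0.
have gs_in : (g, s) \in sqr_sqfree_pairs (2 * k ^ 2).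
  rewrite mem_filter /= gs_le s_ok; apply/allpairsP; exists (g, s) => /=.
  by rewrite !mem_index_iota g0 s0 !ltnS (leq_trans g_le) // (leq_trans s_le).
have gsL : (g ^ 2 * s)%N \in L by apply/mapP; exists (g, s).
rewrite abE mem_cat; case/orP: e12 => /eqP ->; first by rewrite mul1n gsL.
by rewrite (map_f (muln 2) gsL) orbT.
Qed.

(** Needed to absorb the summand 1 above: 1 + 2M <= 3M. *)
Lemma sqr_sqfree_pairs_gt0 (N : nat) : (0 < N)%N ->
  (0 < size (sqr_sqfree_pairs N))%N.
Proof.
move=> N0; suff : (1, 1)%N \in sqr_sqfree_pairs N by case: sqr_sqfree_pairs.
rewrite mem_filter /= N0; apply/allpairsP; exists (1, 1)%N.
by rewrite mem_index_iota /= ltnS N0.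
Qed.

(** * The grid in the double plane and its distances *)

Section Points.
Variable R : realType.

(* The double number <x, y>. *)
Definition dbl_xy (x y : R) : dbl R := Dbl ((x + y) / 2) ((x - y) / 2).

Lemma dbl_xyK (u : dbl R) : dbl_xy (dbl_x u) (dbl_y u) = u.
Proof. by case: u => X Y; rewrite /dbl_xy /dbl_x /dbl_y /=; congr Dbl; lra. Qed.

Lemma dbl_x_xy x y : dbl_x (dbl_xy x y) = x.
Proof. by rewrite /dbl_x /=; lra. Qed.

Lemma dbl_y_xy x y : dbl_y (dbl_xy x y) = y.
Proof. by rewrite /dbl_y /=; lra. Qed.

Definition grid_point (t : (nat * nat) * (nat * nat)) : dbl R * dbl R :=
  (dbl_xy t.1.1%:R t.1.2%:R, dbl_xy t.2.1%:R t.2.2%:R).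

Lemma grid_point_inj : injective grid_point.
Proof.
have coordE t : (dbl_x (grid_point t).1, dbl_y (grid_point t).1,
    dbl_x (grid_point t).2, dbl_y (grid_point t).2)
    = (t.1.1%:R, t.1.2%:R, t.2.1%:R, t.2.2%:R) :> R * R * R * R.
  by rewrite !dbl_x_xy !dbl_y_xy.
move=> t t' tE; have := coordE t; rewrite tE coordE.
case: t t' {tE} => [[a b] [c d]] [[a' b'] [c' d']] /= -[/eqP + /eqP + /eqP + /eqP].
by rewrite !eqr_nat => /eqP-> /eqP-> /eqP-> /eqP->.
Qed.

Definition grid (k : nat) : seq (dbl R * dbl R) :=
  let sq := [seq (a, b) | a <- iota 0 k, b <- iota 0 k] in
  [seq grid_point (u, v) | u <- sq, v <- sq].

Lemma size_grid k : size (grid k) = (k ^ 4)%N.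
Proof. by rewrite !size_allpairs size_iota; lia. Qed.

Lemma uniq_grid k : uniq (grid k).
Proof.
apply: allpairs_uniq; [| |by move=> [u v] [u' v'] _ _ /grid_point_inj];
  apply: allpairs_uniq; rewrite ?iota_uniq // => -[? ?] [? ?] _ _ //.
Qed.

Lemma natr_sqr_dist (a b : nat) : (a%:R - b%:R) ^+ 2 = (`|a - b|%N ^ 2)%:R :> R.
Proof.
by rewrite natrX natr_absz intr_norm rmorphB /= real_normK ?num_real.
Qed.

Lemma sum_sqr_dist_in k (a b c d : nat) :
  (a < k)%N -> (b < k)%N -> (c < k)%N -> (d < k)%N ->
  (`|a - b| ^ 2 + `|c - d| ^ 2)%N \in sums_of_squares k.
Proof.
move=> ak bk ck dk; rewrite mem_undup; apply/allpairsP.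
by exists (`|a - b|, `|c - d|)%N; rewrite !mem_iota /= !add0n; split=> //; lia.
Qed.

(** Each coordinate of a distance is a sum of two squared differences of numbers below k, and
    absolute differences stay below k. *)
Lemma grid_dist k p q : p \in grid k -> q \in grid k ->
  exists u v, [/\ u \in sums_of_squares k, v \in sums_of_squares k &
                  dbl_dist p q = dbl_xy u%:R v%:R].
Proof.
move=> /allpairsP[[[a b] [c d]] /=
  [/allpairsP[[? ?] /= [+ + [-> ->]]] /allpairsP[[? ?] /= [+ + [-> ->]]] ->]].
rewrite !mem_iota /= !add0n => a_lt b_lt c_lt d_lt.
move=> /allpairsP[[[a' b'] [c' d']] /=
  [/allpairsP[[? ?] /= [+ + [-> ->]]] /allpairsP[[? ?] /= [+ + [-> ->]]] ->]].
rewrite !mem_iota /= !add0n => a'_lt b'_lt c'_lt d'_lt.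
eexists; eexists; split; last first.
- by rewrite -[LHS]dbl_xyK dbl_dist_x dbl_dist_y /= !dbl_x_xy
    !dbl_y_xy !natr_sqr_dist -!natrD.
- exact: sum_sqr_dist_in.
exact: sum_sqr_dist_in.
Qed.

(** Stated for subsets of the grid, as exactly n of its points will be taken. *)
Lemma num_dist_grid_le k (P : {fset dbl R * dbl R}) :
  {subset P <= grid k} -> (num_dist P <= size (sums_of_squares k) ^ 2)%N.
Proof.
move=> P_grid; pose Q := sums_of_squares k.
pose E := [seq dbl_xy u%:R v%:R | u <- Q, v <- Q].
apply: (@leq_trans #|` [fset x in E]%fset|).
  apply: fsubset_leq_card; apply/fsubsetP => _ /imfset2P[p pP [q qP ->]].
  have [u [v [uQ vQ ->]]] := grid_dist (P_grid p pP) (P_grid q qP).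
  by rewrite !inE; apply/allpairsP; exists (u, v).
by rewrite card_fseq (leq_trans (size_undup _)) // size_allpairs mulnn.
Qed.
End Points.

Theorem claim4p2 (R : realType) :
  exists C : R, forall n : nat, (2 <= n)%N ->
    exists P : {fset dbl R * dbl R},
      #|` P| = n /\ (num_dist P)%:R <= C * (n%:R / ln n%:R).
Proof.
set c : R := 3 + 2 * ln 4.
(* 4608 = 9 * 2 * 4 * 64, from D_le, ln_le, M_le and N_sqr below. *)
exists (4608 * c ^+ 2) => n n2.
(* For the least k with n <= k^4, minimality gives (k-1)^4 < n, and k <= 2(k-1) because n >= 2
   forces k >= 2. *)
have [k n_le k_min] : exists2 k, (n <= k ^ 4)%N & (k ^ 4 <= 16 * n)%N.
  have ex_k : exists k, (n <= k ^ 4)%N.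
    by exists n; rewrite (leq_trans _ (leq_pexp2l _ (isT : 1 <= 4)%N)) ?expn1
      // ltnW.
  exists (ex_minn ex_k); case: ex_minnP => // k n_le k_min.
  case: k n_le k_min => [|[|k]] n_le k_min; [by lia | by lia |].
  have lt_n : (k.+1 ^ 4 < n)%N.
    by rewrite ltnNge; apply/negP => /k_min; rewrite ltnn.
  apply: leq_trans (_ : 16 * k.+1 ^ 4 <= _)%N; last by rewrite leq_mul2l ltnW.
  by rewrite (_ : 16 = 2 ^ 4)%N // -expnMn leq_exp2r //; lia.
have k2 : (2 <= k)%N by case: k n_le {k_min} => [|[|k]] //; lia.
exists [fset x in take n (grid R k)]%fset; split.
  rewrite card_fseq undup_id ?take_uniq ?uniq_grid // size_take size_grid.
  by case: ltngtP n_le.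
set P := [fset x in _]%fset; set N := (2 * k ^ 2)%N.
set M := size (sqr_sqfree_pairs N).
have N2 : (2 <= N)%N by rewrite /N; nia.
have D_le : (num_dist P)%:R <= 9 * M%:R ^+ 2 :> R.
  rewrite -natrX -natrM ler_nat (leq_trans (@num_dist_grid_le _ k _ _)) //.
    by move=> x; rewrite !inE => /mem_take.
  rewrite (_ : 9 = 3 ^ 2)%N // -expnMn leq_exp2r //.
  apply: leq_trans (size_sums_of_squares_le k) _; rewrite -/N -/M.
  by have := sqr_sqfree_pairs_gt0 (ltnW N2); rewrite -/M; lia.
have M_le := size_sqr_sqfree_pairs_sqr_le R N2; rewrite -/M -/c in M_le.
have ln_n_gt0 : 0 < ln n%:R :> R by rewrite ln_gt0 // ltr1n.
(* From n <= k^4 <= 4 k^4 = N^2. *)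
have ln_le : ln n%:R <= 2 * ln N%:R :> R.
  rewrite mulr_natl -lnXn ?ltr0n ?(ltnW N2) // -natrX.
  rewrite ler_ln ?posrE ?ltr0n ?expn_gt0 ?(ltnW N2) ?(ltnW n2) // ler_nat.
  by apply: leq_trans n_le _; rewrite /N expnMn -expnM leq_pmull.
have N_sqr : N%:R ^+ 2 <= 64 * n%:R :> R.
  by rewrite -natrX -natrM ler_nat /N expnMn -expnM; lia.
rewrite mulrA ler_pdivlMr //.
apply: (@le_trans _ _ (9 * M%:R ^+ 2 * (2 * ln N%:R))).
  by apply: ler_pM => //; rewrite ltW.
have := ler_wpM2l (sqr_ge0 c) N_sqr.
move: M_le; rewrite !exprMn; lra.
Qed.
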